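(* Let $p$ be a prime, let $m\ge 1$, and let $L:\mathbb{F}_p^{m+1}\rightarrow\mathbb{F}_p^m$ be an $\mathbb{F}_p$-linear map of rank $m$. Let $A_1,A_2,\ldots,A_{m+1}\subseteq\mathbb{F}_p$ with $|A_i|=k_i$, and suppose that $\min_i(k_i)+\max_i(k_i)<p$. Let $S\subseteq[m+1]$ be the support of $\ker(L)$ and $S'=[m+1]\setminus S$. Then $$|L(A_1,A_2,\ldots,A_{m+1})|\ \ge\ \Big(\prod_{j\in S'}k_j\Big)\cdot\Big(\prod_{i\in S}k_i-\prod_{i\in S}(k_i-1)\Big).$$
   Context: For a linear map $L:\mathbb{F}_p^{n}\to\mathbb{F}_p^{m}$ and sets $A_1,\ldots,A_n\subseteq\mathbb{F}_p$, $L(A_1,\ldots,A_n)$ denotes the image of $A_1\times\cdots\times A_n$ under $L$. The support of a vector is the set of indices of its nonzero entries. Since $L$ has rank $m$, $\ker(L)$ is one-dimensional, and all its nonzero vectors have the same support; this common support is called the support of $\ker(L)$. $[n]=\{1,\ldots,n\}$.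
   Formalization: The min and max of the k_i are taken over i in S, not all of [m+1] (as printed it is false: p=7, L(x)=(x1+x2,x3), k=(5,5,1) with intervals gives 7 < 9); if some A_i is empty, the bound is read as 0. *)

(* Defs.v *)
From HB Require Import structures.
From mathcomp Require Import all_boot all_order all_algebra.

Set Implicit Arguments.
Unset Strict Implicit.
Unset Printing Implicit Defensive.

Import GRing.Theory.

(* Vectors of F^n are rows; the index set [n] = {1, .., n} is 'I_n. *)

Definition vsupp (F : fieldType) (n : nat) (v : 'rV[F]_n) : {set 'I_n} :=
  [set i | v ord0 i != 0%R].

(* When ker L is a line this holds of exactly one S, since ker L then contains
   a nonzero vector and all such vectors have the same support. *)
Definition is_ker_supp (F : fieldType) (n m : nat)
    (L : 'Hom('rV[F]_n, 'rV[F]_m)) (S : {set 'I_n}) : Prop :=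
  forall v : 'rV[F]_n, v \in lker L -> v != 0%R -> vsupp v = S.

Definition box (F : finFieldType) (n : nat) (A : 'I_n -> {set F}) :
    {set 'rV[F]_n} :=
  [set x : 'rV[F]_n | [forall i, x ord0 i \in A i]].

Definition limage (F : finFieldType) (n m : nat)
    (L : 'Hom('rV[F]_n, 'rV[F]_m)) (A : 'I_n -> {set F}) : {set 'rV[F]_m} :=
  [set L x | x in box A].

(* Meant for k i <= p (cardinalities of subsets of F_p): the value p does not
   affect the minimum over a nonempty S. *)
Definition min_on (p n : nat) (S : {set 'I_n}) (k : 'I_n -> nat) : nat :=
  \big[minn/p]_(i in S) k i.

Definition max_on (n : nat) (S : {set 'I_n}) (k : 'I_n -> nat) : nat :=
  \max_(i in S) k i.

(* Subtractions are those of nat.  They are exact when all k i > 0; when some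
   k i = 0 the bound is 0, whereas the integer expression could be positive
   although the image is empty. *)
Definition image_bound (n : nat) (S : {set 'I_n}) (k : 'I_n -> nat) : nat :=
  (\prod_(j in ~: S) k j) *
  (\prod_(i in S) k i - \prod_(i in S) (k i - 1)).

(* Main.v *)
Require Import Defs.
From HB Require Import structures.
From mathcomp Require Import all_boot all_order all_algebra.
From mathcomp Require Import zify.

(* Let v span ker L, with support S, and let j0 in S minimise k.  The image is in
   bijection with the lines in direction v meeting the box, and each such line
   is represented by its point y with y_j0 = 0: one counts the y such that
   y + b v lies in the box for some b in B, where #|B| = k_j0.  Fixing the
   coordinate y_j = c shrinks B to B_c := {b in B | c + b v_j in A_j}.  The sizes
   of the B_c sum to #|B| k_j and, when v_j != 0, Cauchy-Davenport makes at least
   #|B| + k_j - 1 of them nonempty.  Since the bound in the remaining coordinates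
   is affine in #|B_c| for nonempty B_c, these two facts give the induction
   step.  The hypothesis #|B| + k_j <= p + 1 survives because B only shrinks,
   which is why the smallest set is taken as B. *)

Set Implicit Arguments.
Unset Strict Implicit.
Unset Printing Implicit Defensive.

Import GRing.Theory.

Section LineCount.
Local Open Scope ring_scope.

(** * Cauchy-Davenport in F_p *)

Lemma Fp_shift_closed_setT (p : nat) (A : {set 'F_p}) (d : 'F_p) :
  prime p -> d != 0 -> A != set0 -> (forall x, x \in A -> x + d \in A) ->
  A = setT.
Proof.
move=> p_pr d0 /set0Pn [a aA] stA; apply/setP => x; rewrite inE.
have stn n : a + d *+ n \in A.
  by elim: n => [|n IH]; rewrite ?mulr0n ?addr0 // mulrSr addrA stA.
(* The point [x] is reached from [a] after (x - a) / d shifts, this residue being read as a natural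
   number. *)
have := stn ((x - a) / d : 'F_p).
rewrite -mulr_natr natr_Zp mulrC divfK //.
by rewrite addrC subrK.
Qed.

(* The induction step is Dyson's e-transform: (A, B) becomes
   (A :|: (e + B), B :&: (A - e)), with e chosen so that B shrinks strictly. *)
Lemma Cauchy_Davenport_Fp (p : nat) (A B : {set 'F_p}) :
  prime p -> A != set0 -> B != set0 -> (#|A| + #|B| <= p.+1)%N ->
  (#|A| + #|B| <= #|[set (a + b)%R | a in A, b in B]|.+1)%N.
Proof.
move=> p_pr; have [n] := ubnP #|B|; elim: n A B => // n IH A B ltBn A0 B0 leAB.
have [leB1|B_gt1] := leqP #|B| 1%N.
  have /eqP/cards1P [b eB] : #|B| = 1%N by apply/eqP; rewrite eqn_leq leB1 card_gt0.
  rewrite {1}eB cards1 addn1 ltnS -(card_imset (mem A) (addIr b)).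
  apply/subset_leq_card/subsetP => _ /imsetP [a aA ->].
  by apply/imset2P; exists a b; rewrite // eB inE.
have /card_gt1P [b [b' [bB b'B neq_bb']]] := B_gt1.
have [e ebA eb'A] : exists2 e, e + b \in A & e + b' \notin A.
  case: (pickP (fun e => (e + b \in A) && (e + b' \notin A))) => [e /andP[]|noe].
    by exists e.
  (* Without such an [e], [A] is stable under the nonzero shift [b' - b], hence is all of F_p; since
     [B] has at least two elements, this contradicts [leAB]. *)
  have AT : A = setT.
    apply: (@Fp_shift_closed_setT _ A (b' - b)) => // [|x xA].
      by rewrite subr_eq0 eq_sym.
    have := noe (x - b); rewrite subrK xA /= => /negbFE.
    by rewrite addrAC -addrA.
  by move: leAB; rewrite AT cardsT card_Fp //; lia.
pose eB := [set e + x | x in B].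
pose B1 := [set x in B | e + x \in A].
have card_eq : (#|A :|: eB| + #|B1| = #|A| + #|B|)%N.
  have -> : #|B1| = #|A :&: eB|.
    rewrite -(card_imset (mem B1) (addrI e)); congr #|pred_of_set _|.
    apply/setP => x; rewrite inE; apply/imsetP/andP.
      by case=> y; rewrite inE => /andP [yB yA] ->; rewrite yA imset_f.
    by case=> xA /imsetP [y yB ex]; exists y; rewrite // inE yB -ex.
  by rewrite cardsUI (card_imset _ (addrI e)).
have ltB1 : (#|B1| < #|B|)%N.
  apply/proper_card/properP; split; first by apply/subsetP => x; rewrite inE => /andP[].
  by exists b'; rewrite // inE b'B.
rewrite -card_eq; apply: leq_trans (IH _ _ _ _ _ _) _.
- lia.
- by apply/set0Pn; exists (e + b); rewrite inE ebA.
- by apply/set0Pn; exists b; rewrite inE bB.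
- by rewrite card_eq.
rewrite ltnS; apply/subset_leq_card/subsetP => _ /imset2P [x y xA1 + ->].
rewrite inE => /andP [yB yA].
case/setUP: xA1 => [xA|/imsetP [z zB ->]]; first exact: imset2_f.
(* Here (e + z) + y = (e + y) + z, with e + y in [A] and z in [B]. *)
by rewrite addrAC; apply: imset2_f.
Qed.

(** * Counting the lines that meet the box *)

Variables (p n : nat) (v : 'rV['F_p]_n) (A : 'I_n -> {set 'F_p}).
Hypothesis p_pr : prime p.

Let k i := #|A i|.

(* The points agreeing with y0 outside J that a translation by some b * v,
   b in B, brings into the box on the coordinates in J. *)
Definition translates_into (J : seq 'I_n) (B : {set 'F_p}) (y0 : 'rV['F_p]_n) :=
  [set y : 'rV['F_p]_n | [forall i, (i \in J) || (y ord0 i == y0 ord0 i)] &&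
    [exists b in B, all (fun i => y ord0 i + b * v ord0 i \in A i) J]].

Definition hits (j : 'I_n) (B : {set 'F_p}) (c : 'F_p) :=
  [set b in B | c + b * v ord0 j \in A j].

Lemma card_translates_into_cons (j : 'I_n) J B y0 : j \notin J ->
  (#|translates_into (j :: J) B y0| = \sum_c #|translates_into J (hits j B c)
      (\row_i if i == j then c else y0 ord0 i)|)%N.
Proof.
move=> jJ; rewrite -sum1_card (partition_big (fun y : 'rV_n => y ord0 j) xpredT) //=.
apply: eq_bigr => c _; rewrite -sum1_card; apply: eq_bigl => y.
rewrite !inE; apply/andP/andP.
  case=> /andP [/forallP out /exists_inP [b bB /= /andP [hj hJ]]] /eqP yj.
  split.
    apply/forallP => i; rewrite mxE; have := out i; rewrite inE.
    by have [->|] := eqVneq i j; rewrite /= ?yj ?eqxx ?orbT.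
  by apply/exists_inP; exists b; rewrite // inE bB -yj.
case=> /forallP out /exists_inP [b].
rewrite inE => /andP [bB hj] hJ.
have yj : y ord0 j = c.
  by have := out j; rewrite (negPf jJ) /= mxE eqxx => /eqP.
rewrite yj eqxx; split=> //; apply/andP; split.
  apply/forallP => i; rewrite inE; have := out i; rewrite mxE.
  by have [->|] := eqVneq i j.
by apply/exists_inP; exists b; rewrite //= yj hj.
Qed.

(** Double counting: each b in [B] lies in [hits j B c] for the [k j] values c of a translate of
    [A j]. *)
Lemma sum_card_hits j B : (\sum_c #|hits j B c| = #|B| * k j)%N.
Proof.
have cardE c : #|hits j B c| = (\sum_(b | (b \in B) && (c + b * v ord0 j \in A j)%R) 1)%N.
  by rewrite -sum1_card; apply: eq_bigl => b; rewrite inE.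
under eq_bigr => c _ do rewrite cardE.
rewrite (exchange_big_dep (mem B)) /=; last by move=> c b _ /andP[].
rewrite -sum_nat_const; apply: eq_bigr => b bB.
rewrite bB sum1_card /=.
rewrite /k -(card_imset (mem (A j)) (addIr (- (b * v ord0 j)))).
apply: eq_card => c; rewrite unfold_in /=; apply/idP/imsetP => [cA|[a aA ->]].
  by exists (c + b * v ord0 j)%R; rewrite ?addrK.
by rewrite unfold_in /= subrK.
Qed.

(** [hits j B c] is nonempty when c lies in the sumset of [A j] and -v_j B, and the latter has size
    [#|B|] because v_j is invertible. *)
Lemma card_hits_nonempty j B : v ord0 j != 0 -> B != set0 -> (0 < k j)%N ->
  (#|B| + k j <= p.+1)%N ->
  (#|B| + k j <= (\sum_c (0 < #|hits j B c|)).+1)%N.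
Proof.
move=> vj B0 kj le_p.
have injv : injective (fun b => - (b * v ord0 j)).
  by move=> b b' /oppr_inj/(mulIf vj).
pose B' := [set - (b * v ord0 j) | b in B].
have cB' : #|B'| = #|B| by rewrite card_imset.
have B'0 : B' != set0 by rewrite -card_gt0 cB' card_gt0.
have := @Cauchy_Davenport_Fp p (A j) B' p_pr.
rewrite -card_gt0 => /(_ kj B'0); rewrite cB' addnC => /(_ le_p) /leq_trans; apply.
rewrite ltnS -big_mkcond sum1_card; apply/subset_leq_card/subsetP.
move=> _ /imset2P [a _ aA /imsetP [b bB ->] ->].
suff : (0 < #|hits j B (a - b * v ord0 j)%R|)%N by [].
rewrite card_gt0; apply/set0Pn; exists b.
by rewrite inE bB subrK.
Qed.

(* The truncated subtractions are exact when all k j > 0; the form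
   s (P - Q) + Q equals s P - (s - 1) Q for s > 0. *)
Definition line_bound (J : seq 'I_n) (s : nat) : nat :=
  ((\prod_(j <- J | v ord0 j == 0%R) k j) *
  (s * (\prod_(j <- J | v ord0 j != 0%R) k j
        - \prod_(j <- J | v ord0 j != 0%R) (k j - 1))
   + \prod_(j <- J | v ord0 j != 0%R) (k j - 1) * (0 < s)))%N.

(** Induction on [J] for all [B] and [y0], since fixing a coordinate changes both. *)
Lemma line_bound_le (J : seq 'I_n) (B : {set 'F_p}) (y0 : 'rV['F_p]_n) :
  uniq J -> (forall j, 0 < k j)%N ->
  (forall j, v ord0 j != 0%R -> #|B| + k j <= p.+1)%N ->
  (line_bound J #|B| <= #|translates_into J B y0|)%N.
Proof.
move=> + k_gt0; elim: J B y0 => [|j J IH] B y0 /=.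
  move=> _ _; rewrite /line_bound !big_nil subnn muln0 add0n !mul1n.
  have [->|B0] := eqVneq B set0; first by rewrite cards0.
  rewrite card_gt0 B0 card_gt0; apply/set0Pn; exists y0.
  rewrite inE; apply/andP; split; first by apply/forallP => i; rewrite eqxx orbT.
  by have [b bB] := set0Pn _ B0; apply/exists_inP; exists b.
case/andP => jJ uJ le_p; rewrite card_translates_into_cons //.
have le_hits c : (#|hits j B c| <= #|B|)%N.
  by apply/subset_leq_card/subsetP => b; rewrite inE => /andP[].
apply: leq_trans (leq_sum _ (_ : forall c, true -> line_bound J #|hits j B c| <= _)%N);
  last first.
  by move=> c _; apply: IH => // i /le_p; apply: leq_trans; rewrite leq_add2r.
rewrite /line_bound !big_cons -big_distrr /= big_split /= -big_distrl -big_distrr /=.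
rewrite sum_card_hits.
set N := \big[muln/1%N]_(i <- J | v ord0 i == 0) _.
set P := \big[muln/1%N]_(i <- J | v ord0 i != 0) _.
set Q := \big[muln/1%N]_(i <- J | v ord0 i != 0) (_ - _)%N.
have leQP : (Q <= P)%N.
  by rewrite /Q /P; elim/big_ind2: _ => // [*|i _]; [exact: leq_mul|exact: leq_subr].
have [vj0|vj] /= := eqVneq (v ord0 j) 0.
  (* Translation leaves coordinate [j] alone: [k j] values of c keep all of [B], the others nothing,
     so the two sides are equal. *)
  have hitsE c : hits j B c = if c \in A j then B else set0.
    by apply/setP => b; rewrite inE vj0 mulr0 addr0; case: ifP; rewrite ?andbT ?andbF ?inE.
  have -> : (\sum_c (0 < #|hits j B c|) = k j * (0 < #|B|))%N.
    rewrite -sum_nat_const [RHS]big_mkcond; apply: eq_bigr => c _.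
    by rewrite hitsE; case: ifP; rewrite ?cards0.
  rewrite -mulnA mulnCA; apply/eq_leq; congr (_ * _)%N.
  rewrite mulnDr; congr (_ + _)%N; first by rewrite mulnA [(k j * _)%N]mulnC.
  exact: mulnCA.
rewrite leq_mul2l; apply/orP; right.
have [->|B0] := eqVneq B set0; first by rewrite cards0 !mul0n muln0.
have := card_hits_nonempty vj B0 (k_gt0 j) (le_p j vj).
have := k_gt0 j; have : (0 < #|B|)%N by rewrite card_gt0.
move=> B_gt0; rewrite B_gt0 muln1.
move: (\sum_c _)%N #|B| (k j) => T s [//|a] _ leT.
rewrite subn1 /=.
(* With k_j = a + 1, both sides contain s (a + 1) (P - Q); the rest is Q (s + a) against Q T, where
   T counts the nonempty [hits]. *)
suff : (Q * (s + a) <= Q * T)%N by move: leQP => /subnKC <-; nia.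
by rewrite leq_mul2l; apply/orP; right; lia.
Qed.

End LineCount.

(** * The kernel line and the image *)

Section KernelLine.
Local Open Scope ring_scope.

(** Rank-nullity: the rank is at most m < n. *)
Lemma lker_nonzero (F : fieldType) (n m : nat) (L : 'Hom('rV[F]_n, 'rV[F]_m)) :
  (m < n)%N -> exists2 v, v \in lker L & v != 0.
Proof.
move=> lt_mn; exists (vpick (lker L)); first exact: memv_pick.
rewrite vpick0 -dimv_eq0; apply: contraL lt_mn => /eqP ker0.
rewrite -leqNgt; have := limg_ker_dim L fullv.
rewrite capfv ker0 add0n dimvf /dim /= mul1n => <-.
by have := dimvS (subvf (limg L)); rewrite dimvf /dim /= mul1n.
Qed.

(* A nonzero kernel vector cannot vanish at j0, so L is injective on the rows
   vanishing at j0. *)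
Lemma card_translates_into_le_limage (p n m : nat)
    (L : 'Hom('rV['F_p]_n, 'rV['F_p]_m)) (A : 'I_n -> {set 'F_p})
    (S : {set 'I_n}) (v : 'rV['F_p]_n) (j0 : 'I_n) :
  is_ker_supp L S -> v \in lker L -> j0 \in S ->
  (#|translates_into v A (enum (~: [set j0])) [set b | (b * v ord0 j0)%R \in A j0] 0|
     <= #|limage L A|)%N.
Proof.
move=> hS vL j0S.
have y_j0 J y : j0 \notin J -> y \in translates_into v A J
    [set b | (b * v ord0 j0)%R \in A j0] 0 -> y ord0 j0 = 0.
  move=> j0J; rewrite inE => /andP [/forallP/(_ j0) + _].
  by rewrite (negPf j0J) mxE => /eqP.
have j0J : j0 \notin enum (~: [set j0]) by rewrite mem_enum !inE eqxx.
rewrite -(@card_in_imset _ _ L).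
  apply/subset_leq_card/subsetP => _ /imsetP [y yT ->].
  have y0 := y_j0 _ _ j0J yT.
  move: yT; rewrite inE => /andP [_ /exists_inP [b]].
  rewrite inE => bA /allP bJ.
  apply/imsetP; exists (y + b *: v).
    rewrite inE; apply/forallP => i; rewrite !mxE.
    have [->|ne] := eqVneq i j0; first by rewrite y0 add0r.
    by apply: bJ; rewrite mem_enum !inE.
  by move: vL; rewrite memv_ker linearD linearZ /= => /eqP ->; rewrite scaler0 addr0.
move=> x y xT yT eqL; apply/eqP; rewrite -subr_eq0; apply/negPn/negP => ne0.
have := hS (x - y); rewrite memv_ker linearB /= eqL subrr eqxx => /(_ isT ne0) eqS.
move: j0S; rewrite -eqS inE !mxE.
by rewrite (y_j0 _ _ j0J xT) (y_j0 _ _ j0J yT) subrr eqxx.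
Qed.

End KernelLine.

(** * The minimum over the support, and the final bound *)

Lemma min_on_attained (p n : nat) (S : {set 'I_n}) (k : 'I_n -> nat) :
  S != set0 -> (forall i, k i <= p) -> exists2 j, j \in S & k j = min_on p S k.
Proof.
move=> /set0Pn [i0 i0S] le_kp.
case: (arg_minnP k i0S) => j jS jmin; exists j => //.
apply/eqP; rewrite eqn_leq; apply/andP; split.
  by rewrite /min_on; elim/big_ind: _ => // x y lex ley; rewrite leq_min lex.
(* As [p] is not neutral for [minn] on all of nat, the term of [j] is reached by induction on the
   index list. *)
rewrite /min_on unlock; elim: (index_enum _) (mem_index_enum j) => [|i r IH] /=; first by [].
rewrite in_cons => /predU1P [<-|/IH le_r]; first by have ->: j \in S = true by []; exact: geq_minl.
by case: ifP => _; rewrite ?geq_min ?le_r ?orbT.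
Qed.

Theorem mainTheorem1 (p : nat) (hp : prime p) (m : nat) (hm : 0 < m)
    (L : 'Hom('rV['F_p]_m.+1, 'rV['F_p]_m)) (hL : \dim (limg L) = m)
    (A : 'I_m.+1 -> {set 'F_p}) (k : 'I_m.+1 -> nat)
    (hA : forall i, #|A i| = k i)
    (S : {set 'I_m.+1}) (hS : is_ker_supp L S)
    (hk : min_on p S k + max_on S k < p) :
  image_bound S k <= #|limage L A|.
Proof.
have [v vL v0] := lker_nonzero L (ltnSn m).
have suppS i : (i \in S) = (v ord0 i != 0%R) by rewrite -(hS v vL v0) inE.
have S0 : S != set0.
  apply: contraNneq v0 => S0; apply/eqP/rowP => i.
  by have := suppS i; rewrite S0 inE mxE => /esym/negbFE/eqP.
have le_kp i : k i <= p by rewrite -hA -[X in _ <= X](card_Fp hp) max_card.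
have [j0 j0S kj0] := min_on_attained S0 le_kp.
have [/forallP k_gt0|] := boolP [forall i, 0 < k i]; last first.
  (* An empty [A i] makes the bound 0: for i in [S] the minuend vanishes and the subtraction
     truncates, otherwise the outer product vanishes. *)
  case/forallPn => i; rewrite -eqn0Ngt => /eqP ki.
  rewrite /image_bound; have [iS|niS] := boolP (i \in S).
    by rewrite [X in _ * (X - _)](bigD1 i) //= ki mul0n sub0n muln0.
  by rewrite (bigD1 i) ?inE //= ki !mul0n.
apply: leq_trans (card_translates_into_le_limage A hS vL j0S).
set B := [set b | _]; set J := enum _.
have vj0 : v ord0 j0 != 0%R by rewrite -suppS.
have cB : #|B| = k j0.
  rewrite -hA -(card_imset (mem B) (mulIf vj0)); apply: eq_card => a.
  apply/imsetP/idP => [[b + ->]|aA]; first by rewrite inE.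
  by exists (a / v ord0 j0)%R; rewrite ?inE divfK.
apply: leq_trans (line_bound_le hp _ _ _ _); last first.
(* By the choice of [j0], [#|B|] is the minimum over [S], so [hk] bounds the sum. *)
- move=> i; rewrite -suppS hA cB kj0 => iS.
  have : k i <= max_on S k by exact: leq_bigmax_cond.
  lia.
- by move=> i; rewrite hA.
- exact: enum_uniq.
have prodJ (P : pred 'I_m.+1) F :
    \prod_(i <- J | P i) F i = \prod_(i | (i != j0) && P i) F i.
  by rewrite /J big_enum_cond; apply: eq_bigl => i; rewrite !inE.
rewrite /line_bound /image_bound !prodJ cB k_gt0 muln1.
have -> : \prod_(i in ~: S) k i = \prod_(i | (i != j0) && (v ord0 i == 0%R)) #|A i|.
  apply: eq_big => [i|i _]; last by rewrite hA.
  rewrite inE suppS negbK; have [->|] := eqVneq i j0; last by [].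
  by rewrite (negPf vj0).
rewrite leq_mul2l; apply/orP; right.
(* With s = k j0 split off and P, Q taken over the rest of [S], the target s P - (s - 1) Q equals s
   (P - Q) + Q. *)
rewrite (bigD1 j0) //= [X in _ - X](bigD1 j0) //=.
have condS F : \prod_(i in S | i != j0) F i
    = \prod_(i | (i != j0) && (v ord0 i != 0%R)) F i.
  by apply: eq_bigl => i; rewrite andbC suppS.
rewrite !condS; under [X in _ <= _ * (X - _) + _]eq_bigr do rewrite hA.
under [X in _ <= _ * (_ - X) + _]eq_bigr do rewrite hA.
under [X in _ <= _ + X]eq_bigr do rewrite hA.
set P := \prod_(i | _) k i; set Q := \prod_(i | _) (k i - 1).
have leQP : Q <= P by apply: leq_prod => i _; exact: leq_subr.
have := k_gt0 j0; nia.
Qed.
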